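(* Let $w=\sqrt{(s-2)(2s+1)(2s^2+s+2)}$. The functions $$T_{38}=\frac12+\frac{3(2s+1)(32s^7+32s^6+138s^5+25s^4+130s^3+30s^2+20s-10)}{2(s-2)^2(4s+1)^2(2s^2+s+2)\,w},$$ $$y_{38}=\frac12+\frac{(2s+1)(32s^6-8s^5+164s^4-94s^3+91s^2+2s+18)}{2(s-2)(4s+1)(8s^3+6s-1)\,w}$$ (with the same branch of $w$ in both) parametrize an algebraic solution $y_{38}(T_{38})$ of the sixth Painlev\'e equation $P_{VI}(1/3,1/3,1/3,3/5;T_{38})$.
   Context: $P_{VI}(\theta_0,\theta_1,\theta_T,\theta_\infty;T)$ denotes the sixth Painlev\'e equation $$\begin{aligned}\frac{d^2y}{dT^2}={}&\frac12\left(\frac1y+\frac1{y-1}+\frac1{y-T}\right)\left(\frac{dy}{dT}\right)^2-\left(\frac1T+\frac1{T-1}+\frac1{y-T}\right)\frac{dy}{dT}\\&+\frac{y(y-1)(y-T)}{T^2(T-1)^2}\left(\alpha+\beta\frac{T}{y^2}+\gamma\frac{T-1}{(y-1)^2}+\delta\frac{T(T-1)}{(y-T)^2}\right)\end{aligned}$$ for $y=y(T)$, with $\alpha=\frac{(\theta_\infty-1)^2}{2}$, $\beta=-\frac{\theta_0^2}{2}$, $\gamma=\frac{\theta_1^2}{2}$, $\delta=\frac{1-\theta_T^2}{2}$. That functions $T$ and $y$ on the algebraic curve with coordinates $(s,w)$ parametrize a solution means that $T$ is non-constant and that $y$, viewed locally as a function of $T$, satisfies the equation. *)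

(* Defs.v *)
(* The definitions are given over any algebraically closed field C with a norm.
   The complex numbers are C := R[i] with R : realType; the topology is then
   that of the modulus, and derivatives are complex derivatives. *)
From HB Require Import structures.
From mathcomp Require Import all_boot all_order all_algebra.
From mathcomp Require Import all_classical all_reals all_analysis.
Import Order.TTheory GRing.Theory Num.Theory.
Import numFieldNormedType.Exports.

Set Implicit Arguments.
Unset Strict Implicit.
Unset Printing Implicit Defensive.

Local Open Scope classical_set_scope.
Local Open Scope ring_scope.

Section PainleveVI.
Variable C : numClosedFieldType.
Implicit Types (X : set (C * C)) (T y : C -> C -> C) (Y : C -> C).

Definition PVI_rhs (th0 th1 thT thoo t u u' : C) : C :=
  let alpha := (thoo - 1) ^+ 2 / 2 in
  let beta := - (th0 ^+ 2 / 2) in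
  let gamma := th1 ^+ 2 / 2 in
  let delta := (1 - thT ^+ 2) / 2 in
  1 / 2 * (1 / u + 1 / (u - 1) + 1 / (u - t)) * u' ^+ 2
  - (1 / t + 1 / (t - 1) + 1 / (u - t)) * u'
  + u * (u - 1) * (u - t) / (t ^+ 2 * (t - 1) ^+ 2)
    * (alpha + beta * (t / u ^+ 2) + gamma * ((t - 1) / (u - 1) ^+ 2)
       + delta * (t * (t - 1) / (u - t) ^+ 2)).

(* Division by 0 and derivatives of non-differentiable functions are total in
   the library, so the conditions making the equation meaningful at t are part
   of the definition. *)
Definition PVI_at (th0 th1 thT thoo : C) Y (t : C) : Prop :=
  [/\ [/\ t != 0, t != 1, Y t != 0, Y t != 1 & Y t != t],
      derivable Y t 1,
      derivable (Y^`()%classic) t 1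
    & (Y^`()%classic)^`()%classic t = PVI_rhs th0 th1 thT thoo t (Y t) (Y^`()%classic t)].

(* Functions on a curve X with coordinates (s, w) are rational, hence defined
   outside a finite set of points only: properties of such functions are
   required at all but finitely many points. *)
Definition for_almost_all X (Q : C -> C -> Prop) : Prop :=
  finite_set [set p | X p /\ ~ Q p.1 p.2].

Definition nonconstant_on X T : Prop :=
  ~ exists c : C, for_almost_all X (fun s w => T s w = c).

(* Near (s, w), y is the function Y of T, where Y is a solution on a
   neighbourhood of T s w. *)
Definition local_PVI_solution (th0 th1 thT thoo : C) X T y (s w : C) : Prop :=
  exists Y : C -> C,
    (\forall p \near (s, w), X p -> Y (T p.1 p.2) = y p.1 p.2) /\
    (\forall t \near T s w, PVI_at th0 th1 thT thoo Y t).

Definition algebraically_dependent_on X T y : Prop :=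
  exists2 F : {poly {poly C}}, F != 0 &
    for_almost_all X (fun s w => F.[T s w, y s w] = 0).

Definition parametrizes_algebraic_PVI_solution
    (th0 th1 thT thoo : C) X T y : Prop :=
  [/\ nonconstant_on X T,
      algebraically_dependent_on X T y
    & for_almost_all X (local_PVI_solution th0 th1 thT thoo X T y)].

(* Both branches of the square root w. *)
Definition curve38 : set (C * C) :=
  [set p | let: (s, w) := p in
     w ^+ 2 = (s - 2) * (2 * s + 1) * (2 * s ^+ 2 + s + 2)].

Definition T38 (s w : C) : C :=
  1 / 2
  + 3 * (2 * s + 1)
    * (32 * s ^+ 7 + 32 * s ^+ 6 + 138 * s ^+ 5 + 25 * s ^+ 4
       + 130 * s ^+ 3 + 30 * s ^+ 2 + 20 * s - 10)
    / (2 * (s - 2) ^+ 2 * (4 * s + 1) ^+ 2 * (2 * s ^+ 2 + s + 2) * w).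

Definition y38 (s w : C) : C :=
  1 / 2
  + (2 * s + 1)
    * (32 * s ^+ 6 - 8 * s ^+ 5 + 164 * s ^+ 4 - 94 * s ^+ 3
       + 91 * s ^+ 2 + 2 * s + 18)
    / (2 * (s - 2) * (4 * s + 1) * (8 * s ^+ 3 + 6 * s - 1) * w).

End PainleveVI.

Arguments parametrizes_algebraic_PVI_solution {C}.
Arguments curve38 {C}.
Arguments T38 {C}.
Arguments y38 {C}.

(* Main.v *)
Require Import Defs.
From mathcomp Require Import all_boot all_order all_algebra.
From mathcomp Require Import all_classical all_reals all_analysis.
From mathcomp.real_closed Require Import complex.
From mathcomp Require Import ring zify.
Import Order.TTheory GRing.Theory Num.Theory.
Import numFieldNormedType.Exports.
Local Open Scope ring_scope.
Local Open Scope complex_scope.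

(** Put tau = T - 1/2 and x = y - 1/2.  Both are odd in w, so tau^2 and the
    ratio k = x / tau are rational functions of s alone ([tausq], [ratio]).
    Near a point of the curve where tau and d(tau^2)/ds do not vanish, s is a
    differentiable function of tau^2, hence of T, and y = 1/2 + tau k(s).
    Differentiating, with ' = d/ds,
      dy/dT = k + 2 tau^2 k' / (tau^2)'
    is again a rational function of s alone ([slope]), and
      d^2y/dT^2 = 2 tau (dy/dT)' / (tau^2)'.
    Since theta_0 = theta_1, the symmetry (T, y) -> (1 - T, 1 - y) preserves the
    equation: its right-hand side is tau times an expression in tau^2, k and
    dy/dT ([PVI_rhs_centred]).  After division by tau, the Painleve equation is
    an identity between rational functions of s ([slope_equation]), which is
    verified by normalization.

    The local inverse of s |-> tau^2 comes from algebraic closedness: for v near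
    n(s0)/d(s0), the polynomial n - v d is small at s0 while its derivative is
    not, so it has a root near s0 ([horner_near_root]).  Uniqueness, continuity
    and differentiability of that root follow from the continuity in both
    variables of the difference quotient of n/d ([frac_local_inverse]).

    Counting dimensions shows that any two rational functions of s satisfy a
    polynomial relation ([fractions_dependent]); applied to tau^2 and x^2, it
    yields one between T and y.  T is not constant because tau is odd in w and
    nonzero.  All of this holds away from the roots in s of one polynomial
    ([excluded]), that is, outside a finite subset of the curve. *)

Set Implicit Arguments.
Unset Strict Implicit.

(** * Derivatives and roots of polynomials *)

Section Calculus.
Local Open Scope classical_set_scope.

Lemma is_derive_comp (F : numFieldType) (f g : F -> F) t (df dg : F) :
  is_derive t (1 : F) g dg -> is_derive (g t) (1 : F) f df ->
  is_derive t (1 : F) (f \o g) (df * dg).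
Proof.
move=> [/derivable1_diffP gt <-] [/derivable1_diffP ft <-]; apply: DeriveDef.
  exact/derivable1_diffP/differentiable_comp.
rewrite !deriveE//; last exact: differentiable_comp.
rewrite (diff_comp gt ft).
have -> (D D' : {linear F -> F}) : (D \o D') 1 = D 1 * D' 1 => //.
by rewrite /= -[D' 1 in LHS]mulr1 -[_ * 1]/(_ *: _) linearZ mulrC.
Qed.

Variable C : numClosedFieldType.
Implicit Types (p n d : {poly C}) (s t v a : C).

(** The logarithmic derivative p'/p (a) is the sum of the inverses of the a - z,
    z running over the roots of p, so it is at most deg p / |a - r| for the
    root r nearest to a. *)
Lemma horner_near_root p a : p^`().[a] != 0 ->
  exists2 r, root p r & `|a - r| * `|p^`().[a]| <= (size p)%:R * `|p.[a]|.
Proof.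
move=> p'a0.
have [rs prs] := closed_field_poly_normal p.
have lc0 : lead_coef p != 0.
  by apply: contraNneq p'a0 => /eqP; rewrite lead_coef_eq0 => /eqP ->; rewrite linear0 horner0.
pose q rs : {poly C} := \prod_(z <- rs) ('X - z%:P).
have deriv_le m : 0 <= m -> {in rs, forall z, m <= `|a - z|} ->
    m * `|(q rs)^`().[a]| <= (size rs)%:R * `|(q rs).[a]|.
  move=> m0; rewrite /q; elim: (rs) => [|z rs' IH] mrs.
    by rewrite big_nil derivC horner0 normr0 mulr0 mul0r.
  rewrite big_cons derivM derivXsubC mul1r hornerD !hornerM hornerXsubC normrM.
  set A := (\prod_(j <- rs') _).[a] in IH *.
  set B := (_^`()).[a] in IH *.
  rewrite (le_trans (ler_wpM2l m0 (ler_normD _ _)))// mulrDr normrM /= mulrS mulrDl mul1r.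
  rewrite lerD//; first by rewrite ler_wpM2r// mrs// mem_head.
  rewrite mulrCA [leRHS]mulrCA ler_wpM2l// IH// => y yrs.
  by apply: mrs; rewrite in_cons yrs orbT.
have nearest (x : C) l : exists2 z, z \in x :: l & {in x :: l, forall y, `|a - z| <= `|a - y|}.
  elim: l => [|y l [z zl zmin]].
    by exists x; rewrite ?mem_head// => y; rewrite inE => /eqP ->.
  have /orP[zy|yz] := real_leVge (normr_real (a - z)) (normr_real (a - y)).
    exists z; first by move: zl; rewrite !inE => /orP[->//|->]; rewrite !orbT.
    by move=> w; rewrite !inE => /or3P[/eqP->|/eqP->//|wl]; apply: zmin;
      rewrite !inE ?eqxx ?wl ?orbT.
  exists y; first by rewrite !inE eqxx orbT.
  by move=> w; rewrite !inE => /or3P[/eqP->|/eqP->//|wl]; apply: (le_trans yz); apply: zmin;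
      rewrite !inE ?eqxx ?wl ?orbT.
case: rs => [|z0 rs] in prs deriv_le *.
  by move: p'a0; rewrite prs big_nil derivZ derivC scaler0 horner0 eqxx.
have [z zrs zmin] := nearest z0 rs.
have rz : root p z.
  by rewrite prs rootZ// root_prod_XsubC.
exists z => //.
have {deriv_le} h := deriv_le _ (normr_ge0 (a - z)) zmin; rewrite -/(q _) in prs.
rewrite prs derivZ !hornerZ !normrM [leLHS]mulrCA [leRHS]mulrCA.
rewrite ler_wpM2l// (le_trans h)// ler_wpM2r// ler_nat.
by rewrite size_scale// /q size_prod_XsubC.
Qed.

Lemma is_derive_horner_comp p (S : C -> C) t (dS : C) :
  is_derive t (1 : C) S dS -> is_derive t (1 : C) (fun u => p.[S u]) (p^`().[S t] * dS).
Proof.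
move=> dSt; elim/poly_ind: p => [|p c IH].
  rewrite deriv0 horner0 mul0r.
  under eq_fun do rewrite horner0; exact: is_derive_cst.
under eq_fun do rewrite hornerMXaddC.
apply: is_derive_eq; rewrite derivMXaddC hornerD hornerMX.
by rewrite addr0 /GRing.scale/=; ring.
Qed.

Lemma horner_continuous p : continuous (horner p).
Proof.
move=> x; apply/differentiable_continuous/derivable1_diffP.
by have [] := is_derive_horner_comp p (is_derive_id x 1).
Qed.

(** The difference quotient (p(x) - p(y)) / (x - y) is itself a polynomial, hence
    extends continuously to the diagonal, with value p'. *)
Lemma horner_slope p : exists h : C * C -> C,
  [/\ continuous h, forall x y, p.[x] - p.[y] = (x - y) * h (x, y)
    & forall x, h (x, x) = p^`().[x]].
Proof.
elim/poly_ind: p => [|p c [h [hc hE hd]]].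
  exists (fun=> 0); split=> [|x y|x]; first exact: cst_continuous.
  - by rewrite !horner0 subrr mulr0.
  - by rewrite deriv0 horner0.
exists (fun z => p.[z.1] + z.2 * h z); split=> [z|x y|x] /=.
- apply: cvgD; last by apply: cvgM; [exact: cvg_snd|exact: hc].
  by apply: continuous_comp; [exact: cvg_fst|exact: horner_continuous].
- rewrite !hornerMXaddC.
  transitivity ((x - y) * p.[x] + y * (p.[x] - p.[y])); first by ring.
  by rewrite hE; ring.
- by rewrite hd derivMXaddC hornerD hornerMX mulrC.
Qed.

(** The numerator of the derivative of n/d over the denominator d^2. *)
Definition wronskian n d : {poly C} := n^`() * d - n * d^`().

Lemma is_derive_frac_comp n d (S : C -> C) t (dS : C) : d.[S t] != 0 ->
  is_derive t (1 : C) S dS ->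
  is_derive t (1 : C) (fun u => n.[S u] / d.[S u])
    ((wronskian n d).[S t] / d.[S t] ^+ 2 * dS).
Proof.
move=> dt0 dSt.
have dV : is_derive t (1 : C) (fun u => (d.[S u])^-1)
    (- d.[S t] ^- 2 * (d^`().[S t] * dS)).
  have [dd dE] := is_derive_horner_comp d dSt.
  by split; [exact: derivableV|rewrite deriveV// dE].
apply: is_derive_eq (is_deriveM (is_derive_horner_comp n dSt) dV) _.
by rewrite /wronskian !hornerE /GRing.scale/=; field.
Qed.

(** * Local inversion of rational functions *)

Lemma affine_continuous (a b : C) : continuous (fun z : C => a + z * b).
Proof.
have <- : horner (a%:P + 'X * b%:P) = fun z => a + z * b.
  by apply/funext => z; rewrite !hornerE.
exact: horner_continuous.
Qed.

(** With G = n/d, the identity x - y = (G x - G y) phi (x, y), where phi is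
    continuous at (s0, s0), makes G injective near s0, makes its inverse S
    Lipschitz because phi is bounded, and then gives S the derivative
    phi (S v, S v).  Existence of S v is the existence of a root of n - v d
    near s0. *)
Lemma frac_local_inverse n d s0 : d.[s0] != 0 -> (wronskian n d).[s0] != 0 ->
  exists S : C -> C,
    (\forall s \near s0, S (n.[s] / d.[s]) = s) /\
    (\forall v \near n.[s0] / d.[s0], [/\ d.[S v] != 0, n.[S v] / d.[S v] = v
       & is_derive v (1 : C) S (d.[S v] ^+ 2 / (wronskian n d).[S v])]).
Proof.
move=> d0 W0; pose G s := n.[s] / d.[s]; rewrite -!/(G _).
have [hn [hnc hnE hnD]] := horner_slope n.
have [hd [hdc hdE hdD]] := horner_slope d.
(* n(x) d(y) - n(y) d(x) = (x - y) H(x, y) *)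
pose H z := hn z * d.[z.2] - n.[z.2] * hd z.
have Hdiag x : H (x, x) = (wronskian n d).[x].
  by rewrite /H hnD hdD /wronskian !hornerE.
pose phi z := d.[z.1] * d.[z.2] / H z.
have Hc : continuous H.
  move=> z; have c2 p : (fun z : C * C => p.[z.2]) @ z --> p.[z.2].
    by apply: continuous_comp; [exact: cvg_snd|exact: horner_continuous].
  by apply: cvgB; apply: cvgM; [exact: hnc|exact: c2|exact: c2|exact: hdc].
have phic z : H z != 0 -> {for z, continuous phi}.
  move=> Hz; apply: cvgM; last by apply: cvgV => //; exact: Hc.
  by apply: cvgM; apply: continuous_comp; [exact: cvg_fst|exact: horner_continuous|exact: cvg_snd|exact: horner_continuous].
have phiE x y : d.[x] != 0 -> d.[y] != 0 -> H (x, y) != 0 ->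
    x - y = (G x - G y) * phi (x, y).
  move=> dx dy Hxy; rewrite /G /phi/=.
  have : n.[x] * d.[y] - n.[y] * d.[x] = (x - y) * H (x, y).
    transitivity ((n.[x] - n.[y]) * d.[y] - n.[y] * (d.[x] - d.[y])); first by ring.
    by rewrite hnE hdE /H/=; ring.
  move=> e; apply: (mulIf Hxy); rewrite -e; field.
  by rewrite Hxy dx dy.
have H0 : H (s0, s0) != 0 by rewrite Hdiag.
pose M := `|phi (s0, s0)| + 1.
have [e e0 Ue] : exists2 e : C, 0 < e & forall x y, `|s0 - x| < e -> `|s0 - y| < e ->
    [/\ d.[x] != 0, H (x, y) != 0 & `|phi (x, y)| < M].
  have : \forall z \near (s0, s0), [/\ d.[z.1] != 0, H z != 0 & `|phi z| < M].
    near=> z; split; near: z.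
    - apply: (cvgr_neq0 d.[s0]) => //.
      by apply: continuous_comp; [exact: cvg_fst|exact: horner_continuous].
    - by apply: (cvgr_neq0 (H (s0, s0))) => //; exact: Hc.
    - apply: (cvgr_norm_lt (phi (s0, s0))); first exact: phic.
      by rewrite /M ltrDl.
  move=> /nbhs_ballP[e /= e0 he]; exists e => // x y xe ye.
  by apply: (he (x, y)); split; rewrite /= -ball_normE.
pose U s := `|s0 - s| < e.
have Ud s : U s -> d.[s] != 0 by move=> Us; have [] := Ue s s.
have Ginj x y : U x -> U y -> G x = G y -> x = y.
  move=> Ux Uy Gxy; apply/eqP; rewrite -subr_eq0 phiE ?Gxy ?subrr ?mul0r ?Ud//.
  by have [] := Ue x y.
pose S v := xget s0 [set s | U s /\ G s = v].
have SE v s : U s -> G s = v -> U (S v) /\ G (S v) = v.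
  by move=> Us Gs; rewrite /S; case: xgetP => [x _ []//|/(_ s)[]].
have Unear : \forall s \near s0, U s by apply/nbhs_ballP; exists e; rewrite ?ball_normE.
(* The root of n - v d given by horner_near_root lies at distance at most
   k |P v (s0)| / |(P v)'(s0)|, a continuous function of v that vanishes at
   v = G s0. *)
have SnearG : \forall v \near G s0, U (S v) /\ G (S v) = v.
  pose k : C := (maxn (size n) (size d))%:R.
  pose P v := n - v *: d.
  have PE v a : (P v).[a] = n.[a] + v * - d.[a] by rewrite /P !hornerE mulrN.
  have P'E v a : (P v)^`().[a] = n^`().[a] + v * - d^`().[a] by rewrite /P derivB derivZ !hornerE mulrN.
  have Pc v : (fun v => (P v).[s0]) @ v --> (P v).[s0].
    under eq_fun do rewrite PE; rewrite PE.
    exact: affine_continuous.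
  have P'c v : (fun v => (P v)^`().[s0]) @ v --> (P v)^`().[s0].
    under eq_fun do rewrite P'E; rewrite P'E.
    exact: affine_continuous.
  have P'0 : (P (G s0))^`().[s0] != 0.
    apply: contraNneq W0; rewrite P'E /G mulrN => h.
    rewrite /wronskian !hornerE; apply/eqP.
    transitivity ((n^`().[s0] - n.[s0] / d.[s0] * d^`().[s0]) * d.[s0]); last by rewrite h mul0r.
    by field.
  have P0 : (P (G s0)).[s0] = 0 by rewrite PE /G mulrN divfK// subrr.
  have Qc : (fun v => k * (P v).[s0] / (P v)^`().[s0]) @ G s0 -->
      k * (P (G s0)).[s0] / (P (G s0))^`().[s0].
    by apply: (cvgM (cvgM (cvg_cst k) (Pc _)) (cvgV P'0 (P'c _))).
  near=> v.
  have P'v : (P v)^`().[s0] != 0 by near: v; exact: cvgr_neq0 (P'c _) P'0.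
  have [r rr rle] := horner_near_root P'v.
  have Ur : U r.
    have : `|k * (P v).[s0] / (P v)^`().[s0]| < e.
      by near: v; apply: (cvgr_norm_lt _ Qc); rewrite P0 mulr0 mul0r normr0.
    apply: le_lt_trans; rewrite normf_div normrM normr_nat ler_pdivlMr ?normr_gt0//.
    rewrite (le_trans rle)// ler_wpM2r// ler_nat.
    by rewrite (leq_trans (size_polyD _ _))// geq_max leq_maxl size_polyN/= (leq_trans (size_scale_leq _ _))// leq_maxr.
  apply: (SE v r) => //; move: rr; rewrite /root PE mulrN subr_eq0 => /eqP rr.
  by rewrite /G rr mulfK// Ud.
exists S; split.
  near=> s; have Us : U s by near: s.
  by have [USG GSG] := SE (G s) s Us erefl; apply: Ginj.
near=> v.
have [USv GSv] : U (S v) /\ G (S v) = v by near: v.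
split; [exact: Ud|exact: GSv|].
have Snear : \forall v' \near v, S v' - S v = (v' - v) * phi (S v', S v) /\ `|phi (S v', S v)| < M.
  have /filterS : \forall v' \near v, U (S v') /\ G (S v') = v' by near: v; exact: (near_join SnearG).
  apply=> v' [USv' GSv']; have [dS HS phiS] := Ue _ _ USv' USv.
  by rewrite phiE ?GSv' ?GSv ?Ud.
have Sc : S @ v --> S v.
  have M0 : 0 < M by rewrite /M ltr_wpDl.
  apply: (@cvgrPdist_lt _ _ _ (nbhs v) _ S (S v)).2 => eps eps0; near=> v'.
  have [SvE phiM] : S v' - S v = (v' - v) * phi (S v', S v) /\ `|phi (S v', S v)| < M by near: v'.
  rewrite distrC SvE normrM (@le_lt_trans _ _ (`|v' - v| * M))//.
    by rewrite ler_wpM2l// ltW.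
  rewrite -ltr_pdivlMr//; near: v'; rewrite /=; apply/nbhs_ballP; exists (eps / M) => /=.
    exact: divr_gt0.
  by move=> z; rewrite -ball_normE/= distrC.
have HSv : H (S v, S v) != 0 by have [] := Ue _ _ USv USv.
have shv : (fun h : C => h + v) @ 0^' --> v.
  have /continuous_withinNx : {for 0, continuous (fun h : C => h + v)}.
    have := @affine_continuous v 1 0.
    by under eq_fun do rewrite mulr1 addrC.
  by rewrite add0r.
have cvgD : (fun h : C => h^-1 *: ((S \o shift v) (h *: (1 : C)) - S v)) @ 0^' -->
   d.[S v] ^+ 2 / (wronskian n d).[S v].
  have -> : d.[S v] ^+ 2 / (wronskian n d).[S v] = phi (S v, S v).
    by rewrite /phi /= Hdiag expr2.
  apply: (@cvg_trans _ ((fun h => phi (S (h + v), S v)) @ 0^')).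
    apply: near_eq_cvg; near=> h => /=.
    have h0 : h != 0 by near: h; exact: nbhs_dnbhs_neq.
    have [SE' _] : S (h + v) - S v = (h + v - v) * phi (S (h + v), S v) /\ `|phi (S (h + v), S v)| < M.
      by near: h; exact: (shv _ Snear).
    by rewrite [_%:A]mulr1 SE' addrK /GRing.scale/= mulKf.
  have Sh : S (h + v) @[h --> 0^'] --> S v := cvg_comp _ _ shv Sc.
  have Sh2 : (S (h + v), S v) @[h --> 0^'] --> (S v, S v).
    exact: (cvg_pair Sh (cvg_cst (S v))).
  exact: cvg_comp Sh2 (phic _ HSv).
split; first by apply/cvg_ex; eexists; exact: cvgD.
exact: cvg_lim cvgD.
Unshelve. all: end_near.
Qed.
End Calculus.

(** * Algebraic dependence of rational functions *)

Section Dependence.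
Variable F : fieldType.

Lemma poly_family_dependent (I : finType) (m : nat) (p : I -> {poly F}) :
  (forall i, (size (p i) <= m)%N) -> (m < #|I|)%N ->
  exists2 c : I -> F, exists i, c i != 0 & \sum_i c i *: p i = 0.
Proof.
move=> pm mI.
pose A := \matrix_(k < #|I|, l < m) (p (enum_val k))`_l.
pose v := nz_row (kermx A).
have v0 : v != 0.
  rewrite nz_row_eq0 -mxrank_eq0 mxrank_ker -lt0n subn_gt0.
  exact: leq_ltn_trans (rank_leq_col A) mI.
have vA : v *m A = 0 by apply/sub_kermxP/nz_row_sub.
exists (fun i => v 0 (enum_rank i)).
  have /rV0Pn[k vk] := v0.
  by exists (enum_val k); rewrite enum_valK.
apply/polyP => l; rewrite coef0 coef_sum.
under eq_bigr do rewrite coefZ.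
have [lm|ml] := ltnP l m; last first.
  by rewrite big1// => i _; rewrite nth_default ?mulr0// (leq_trans (pm i)).
have /rowP/(_ (Ordinal lm)) := vA; rewrite !mxE => vAl; rewrite -[RHS]vAl.
rewrite (reindex (@enum_rank I)); last exact/onW_bij/enum_rank_bij.
by apply: eq_bigr => i _; rewrite mxE enum_rankK.
Qed.

(** The products f1^i f2^j with i, j <= N have the common denominator
    (d1 d2)^N and numerators of degree at most (m1 + m2) N.  For
    N = m1 + m2 + 1 there are (N + 1)^2 > (m1 + m2) N + 1 of them, so they are
    linearly dependent. *)
Lemma fractions_dependent (n1 d1 n2 d2 : {poly F}) :
  exists2 Phi : {poly {poly F}}, Phi != 0 &
    forall s, d1.[s] != 0 -> d2.[s] != 0 ->
      Phi.[n1.[s] / d1.[s], n2.[s] / d2.[s]] = 0.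
Proof.
pose m1 := maxn (size n1) (size d1); pose m2 := maxn (size n2) (size d2).
pose N := (m1 + m2).+1.
pose mono (n d : {poly F}) (i : 'I_N.+1) := n ^+ i * d ^+ (N - i).
have mono_size n d i : (size (mono n d i) <= (maxn (size n) (size d) * N).+1)%N.
  have iN : (i <= N)%N by rewrite -ltnS.
  have := size_poly_exp_leq n i; have := size_poly_exp_leq d (N - i).
  have := leq_maxl (size n) (size d); have := leq_maxr (size n) (size d).
  have := size_polyMleq (n ^+ i) (d ^+ (N - i)); rewrite -/(mono n d i).
  move: (size (mono _ _ _)) (size (n ^+ i)) (size (d ^+ (N - i))) (size n) (size d) (maxn _ _).
  move=> z x y a b M; nia.
have [||c [ij cij] cE] := @poly_family_dependent ('I_N.+1 * 'I_N.+1)%type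
    ((m1 + m2) * N).+1 (fun ij => mono n1 d1 ij.1 * mono n2 d2 ij.2).
- move=> [i j] /=.
  have := size_polyMleq (mono n1 d1 i) (mono n2 d2 j).
  have := mono_size n1 d1 i; have := mono_size n2 d2 j; rewrite -/m1 -/m2.
  move: (size (mono n1 d1 i)) (size (mono n2 d2 j)) (size (mono n1 d1 i * mono n2 d2 j)) => x y z; nia.
- by rewrite card_prod card_ord /N; nia.
pose row (i : nat) : {poly F} := \poly_(j < N.+1) c (inord i, inord j).
exists (\poly_(i < N.+1) row i).
  apply: contraNneq cij => /polyP/(_ ij.1); rewrite coef_poly ltn_ord coef0 => /polyP/(_ ij.2).
  by rewrite coef_poly ltn_ord coef0 !inord_val -surjective_pairing => ->.
move=> s d10 d20; rewrite horner_poly horner_sum.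
transitivity (\sum_ij c (ij.1, ij.2) * ((n1.[s] / d1.[s]) ^+ ij.1 * (n2.[s] / d2.[s]) ^+ ij.2)).
  rewrite -(pair_bigA _ (fun i j => c (i, j) * ((n1.[s] / d1.[s]) ^+ i * (n2.[s] / d2.[s]) ^+ j))) /=.
  apply: eq_bigr => i _; rewrite hornerM horner_exp hornerC /row horner_poly mulr_suml.
  by apply: eq_bigr => j _; rewrite !inord_val mulrAC mulrA.
apply: (mulIf (_ : d1.[s] ^+ N * d2.[s] ^+ N != 0)); first by rewrite mulf_neq0 ?expf_neq0.
rewrite mul0r mulr_suml -[RHS](horner0 s) -cE horner_sum.
apply: eq_bigr => -[i j] _ /=; rewrite hornerZ /mono !hornerM !horner_exp -[LHS]mulrA; congr (_ * _).
have e (x y : F) (k : nat) : (k < N.+1)%N -> y != 0 -> (x / y) ^+ k * y ^+ N = x ^+ k * y ^+ (N - k).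
  move=> kN y0; rewrite ltnS in kN.
  by rewrite -[X in y ^+ X](subnKC kN) exprD mulrA -exprMn divfK.
by rewrite mulrACA !e// mulrA.
Qed.

(** A relation between (T - 1/2)^2 and (y - 1/2)^2 is one between T and y: the
    substitution of nonconstant polynomials is injective on polynomials. *)
Lemma dependence_of_centred_squares (a : F) (Phi : {poly {poly F}}) : Phi != 0 ->
  exists2 Psi : {poly {poly F}}, Psi != 0 &
    forall x y, Psi.[x, y] = Phi.[(x - a) ^+ 2, (y - a) ^+ 2].
Proof.
move=> Phi0.
pose q : {poly F} := ('X - a%:P) ^+ 2.
pose Q : {poly {poly F}} := ('X - a%:P%:P) ^+ 2.
have size_q : (1 < size q)%N by rewrite size_exp_XsubC.
have size_Q : (1 < size Q)%N by rewrite size_exp_XsubC.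
have q_inj : injective (comp_poly q).
  by apply: raddf_inj => p /eqP; rewrite comp_poly_eq0// => /eqP.
exists (map_poly (comp_poly q) Phi \Po Q).
  rewrite comp_poly_eq0//.
  apply: contra_neq Phi0 => h; apply: (map_inj_poly q_inj); first exact: comp_poly0.
  by rewrite h rmorph0.
move=> x y; rewrite horner_comp.
have -> : Q.[x%:P] = ((x - a) ^+ 2)%:P \Po q.
  by rewrite comp_polyC /Q !hornerE -polyCB -rmorphXn.
by rewrite horner_map horner_comp /q !hornerE.
Qed.
End Dependence.

(** * Functions on the curve *)

Section Solution38.
Local Open Scope classical_set_scope.
Variable C : numClosedFieldType.
Implicit Types s t w : C.

(** Over each root of q the curve has at most two points. *)
Lemma for_almost_all_curve38 (q : {poly C}) (Q : C -> C -> Prop) : q != 0 ->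
  (forall s w, curve38 (s, w) -> q.[s] != 0 -> Q s w) -> for_almost_all curve38 Q.
Proof.
move=> q0 qQ.
have [rs qE] := closed_field_poly_normal q.
pose W (s : C) := (s - 2) * (2 * s + 1) * (2 * s ^+ 2 + s + 2).
pose ps := [seq (s, w) | s <- rs, w <- [:: sqrtC (W s); - sqrtC (W s)]].
apply: (@sub_finite_set _ _ [set` ps]); last exact: finite_seq.
move=> [s w] /= [sw nQ].
have qs : q.[s] == 0 by apply/negPn/negP => /(qQ s w sw)/nQ.
have srs : s \in rs.
  by move: qs; rewrite -/(root q s) qE rootZ ?lead_coef_eq0// root_prod_XsubC.
apply/allpairsPdep; exists s, w; split => //.
by rewrite !inE -eqf_sqr sqrtCK; apply/eqP.
Qed.

(** If T were c off a finite set, some s would be neither a root of q nor the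
    first coordinate of an exceptional point; T would take the value c at both
    points above s. *)
Lemma nonconstant_curve38 (q : {poly C}) (T : C -> C -> C) : q != 0 ->
  (forall s w, curve38 (s, w) -> q.[s] != 0 -> T s w != T s (- w)) ->
  nonconstant_on curve38 T.
Proof.
move=> q0 qT [c /finite_seqP[l lE]].
have : q * \prod_(p <- l) ('X - p.1%:P) != 0.
  by rewrite mulf_neq0// prodf_seq_neq0; apply/allP => p _; rewrite polyXsubC_eq0.
move=> /closed_nonrootP[s]; rewrite rootM negb_or => /andP[qs ls].
have Tc w : curve38 (s, w) -> T s w = c.
  move=> sw; apply: contrapT => nT.
  have : (s, w) \in l by have : [set` l] (s, w) by rewrite -lE.
  move=> sl; move: ls; rewrite /root horner_prod prodf_seq_neq0 => /allP/(_ _ sl).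
  by rewrite /= hornerXsubC subrr eqxx.
pose w := sqrtC ((s - 2) * (2 * s + 1) * (2 * s ^+ 2 + s + 2)).
have sw : curve38 (s, w) by rewrite /curve38/= sqrtCK.
have sNw : curve38 (s, - w) by rewrite /curve38/= sqrrN sqrtCK.
by have := qT s w sw qs; rewrite !Tc// eqxx.
Qed.

(** * The factors of the parametrization *)

(** The factors of the functions involved, with coefficients listed by
    increasing degree.  The product pA pB pQ is w^2; pF, pC, pN and pM are the
    further factors of the numerators and denominators of T - 1/2 and
    y - 1/2.  The numerators of T (T - 1), y - T, y (y - 1) and dy/dT bring in
    pU, pV and pW, then pE, pX and pP respectively. *)
Definition pA : {poly C} := Poly [:: - 2; 1].
Definition pB : {poly C} := Poly [:: 1; 2].
Definition pF : {poly C} := Poly [:: 1; 4].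
Definition pQ : {poly C} := Poly [:: 2; 1; 2].
Definition pC : {poly C} := Poly [:: - 1; 6; 0; 8].
Definition pN : {poly C} := Poly [:: - 10; 20; 30; 130; 25; 138; 32; 32].
Definition pM : {poly C} := Poly [:: 18; 2; 91; - 94; 164; - 8; 32].
Definition pU : {poly C} := Poly [:: 17; - 2; 8].
Definition pV : {poly C} := Poly [:: 1; - 1; 4].
Definition pW : {poly C} := Poly [:: 1; 1].
Definition pE : {poly C} := Poly [:: 3; 2; 2].
Definition pX : {poly C} := Poly [:: 1; 2; 2; - 4; 4].
Definition pP : {poly C} := Poly [:: - 13; - 216; - 285; 30; 594; 384; 1008; 0; 480; 128].

Lemma horner_Poly_cons c l s : (Poly (c :: l)).[s] = (Poly l).[s] * s + c.
Proof. by rewrite [Poly _]cons_poly_def hornerMXaddC. Qed.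

Lemma deriv_Poly_cons c l s :
  (Poly (c :: l))^`().[s] = (Poly l).[s] + (Poly l)^`().[s] * s.
Proof. by rewrite [Poly _]cons_poly_def derivMXaddC hornerD hornerMX. Qed.

Lemma Poly0 : Poly [::] = 0 :> {poly C}.
Proof. exact: poly_inj. Qed.

(** tau^2, k = x / tau, dy/dT and x^2, as fractions of polynomials in s. *)
Definition tausq_num := 9 *: (pB * pN ^+ 2).
Definition tausq_den := 4 *: (pA ^+ 5 * pF ^+ 4 * pQ ^+ 3).
Definition ratio_num := pM * pA * pF * pQ.
Definition ratio_den := 3 *: (pC * pN).
Definition slope_num := pP * pA * pF * pQ.
Definition slope_den := 3 *: (pC ^+ 2 * pU * pV * pW ^+ 3).
Definition xsq_num := pB * pM ^+ 2.
Definition xsq_den := 4 *: (pA ^+ 3 * pF ^+ 2 * pC ^+ 2 * pQ).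

Ltac unfold_Poly := rewrite ?(horner_Poly_cons, deriv_Poly_cons) !Poly0 ?deriv0 !horner0; ring.

Lemma factorE s :
   (pA.[s] = s - 2) *
   (pB.[s] = 2 * s + 1) *
   (pF.[s] = 4 * s + 1) *
   (pQ.[s] = 2 * s ^+ 2 + s + 2) *
   (pC.[s] = 8 * s ^+ 3 + 6 * s - 1) *
   (pN.[s] = 32 * s ^+ 7 + 32 * s ^+ 6 + 138 * s ^+ 5 + 25 * s ^+ 4 + 130 * s ^+ 3 + 30 * s ^+ 2 + 20 * s - 10) *
   (pM.[s] = 32 * s ^+ 6 - 8 * s ^+ 5 + 164 * s ^+ 4 - 94 * s ^+ 3 + 91 * s ^+ 2 + 2 * s + 18) *
   (pU.[s] = 8 * s ^+ 2 - 2 * s + 17) *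
   (pV.[s] = 4 * s ^+ 2 - s + 1) *
   (pW.[s] = s + 1) *
   (pE.[s] = 2 * s ^+ 2 + 2 * s + 3) *
   (pX.[s] = 4 * s ^+ 4 - 4 * s ^+ 3 + 2 * s ^+ 2 + 2 * s + 1) *
   (pP.[s] = 128 * s ^+ 9 + 480 * s ^+ 8 + 1008 * s ^+ 6 + 384 * s ^+ 5 + 594 * s ^+ 4 + 30 * s ^+ 3 - 285 * s ^+ 2 - 216 * s - 13).
Proof. by do !split; rewrite /pA /pB /pF /pQ /pC /pN /pM /pU /pV /pW /pE /pX /pP; unfold_Poly. Qed.

Lemma deriv_factorE s :
   (pA^`().[s] = 1) *
   (pB^`().[s] = 2) *
   (pF^`().[s] = 4) *
   (pQ^`().[s] = 4 * s + 1) *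
   (pC^`().[s] = 24 * s ^+ 2 + 6) *
   (pN^`().[s] = 224 * s ^+ 6 + 192 * s ^+ 5 + 690 * s ^+ 4 + 100 * s ^+ 3 + 390 * s ^+ 2 + 60 * s + 20) *
   (pM^`().[s] = 192 * s ^+ 5 - 40 * s ^+ 4 + 656 * s ^+ 3 - 282 * s ^+ 2 + 182 * s + 2) *
   (pU^`().[s] = 16 * s - 2) *
   (pV^`().[s] = 8 * s - 1) *
   (pW^`().[s] = 1) *
   (pP^`().[s] = 1152 * s ^+ 8 + 3840 * s ^+ 7 + 6 * 1008 * s ^+ 5 + 1920 * s ^+ 4 + 2376 * s ^+ 3 + 90 * s ^+ 2 - 570 * s - 216).
Proof. by do !split; rewrite /pA /pB /pF /pQ /pC /pN /pM /pU /pV /pW /pE /pX /pP; unfold_Poly. Qed.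

Lemma derivMp (p q : {poly C}) s : (p * q)^`().[s] = p^`().[s] * q.[s] + p.[s] * q^`().[s].
Proof. by rewrite derivM hornerD !hornerM. Qed.
Lemma derivXp (p : {poly C}) n s : (p ^+ n.+1)^`().[s] = n.+1%:R * p^`().[s] * p.[s] ^+ n.
Proof. by rewrite deriv_exp hornerMn hornerM horner_exp -mulr_natl mulrA. Qed.
Lemma derivZp c (p : {poly C}) s : (c *: p)^`().[s] = c * p^`().[s].
Proof. by rewrite derivZ hornerZ. Qed.
Lemma wronskianE (n d : {poly C}) s :
  (wronskian n d).[s] = n^`().[s] * d.[s] - n.[s] * d^`().[s].
Proof. by rewrite /wronskian hornerD hornerN !hornerM. Qed.

Ltac split_factors := rewrite ?wronskianE /tausq_num /tausq_den /ratio_num /ratio_den /slope_num /slope_den ?(derivZp, derivXp, derivMp, hornerZ, horner_exp, hornerM) /=.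

(** Away from its roots, w, tau, T (T - 1), y (y - 1), y - T and d(tau^2)/ds are
    finite and nonzero. *)
Definition excluded : {poly C} :=
  pA * pB * pF * pQ * pC * pN * pU * pV * pW * pE * pX.

Lemma excluded_neq0 : excluded != 0.
Proof.
suff: excluded.[0] != 0 by apply: contraNneq => ->; rewrite horner0.
rewrite /excluded !hornerM !factorE.
by rewrite !expr0n !(mulr0,add0r, subr0,sub0r) !mulf_neq0 ?oppr_eq0 ?pnatr_eq0.
Qed.

Lemma excludedP s : excluded.[s] != 0 ->
  [/\ [/\ pA.[s] != 0, pB.[s] != 0, pF.[s] != 0 & pQ.[s] != 0],
      [/\ pC.[s] != 0, pN.[s] != 0, pU.[s] != 0 & pV.[s] != 0]
    & [/\ pW.[s] != 0, pE.[s] != 0 & pX.[s] != 0]].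
Proof.
rewrite /excluded !hornerM !mulf_eq0 !negb_or.
by do 10 (move=> /andP[]; move=> + ?); move=> ?; split; split.
Qed.

(** tau^2 is ramified, as a function of s, only over 0, 1/4 and infinity, so its
    derivative has no factors but those above. *)
Lemma tausq_wronskian s : (wronskian tausq_num tausq_den).[s] =
  -1440 * (pA.[s] ^+ 4 * pF.[s] ^+ 3 * pQ.[s] ^+ 2 * pN.[s] * pU.[s] * pV.[s] ^+ 2 * pW.[s] ^+ 4).
Proof. split_factors; rewrite !deriv_factorE !factorE; ring. Qed.

Definition tausq s := tausq_num.[s] / tausq_den.[s].
Definition tausq' s := (wronskian tausq_num tausq_den).[s] / tausq_den.[s] ^+ 2.
Definition ratio s := ratio_num.[s] / ratio_den.[s].
Definition slope s := slope_num.[s] / slope_den.[s].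
Definition slope' s := (wronskian slope_num slope_den).[s] / slope_den.[s] ^+ 2.

Lemma den_neq0 s : excluded.[s] != 0 ->
  [/\ tausq_den.[s] != 0, ratio_den.[s] != 0, slope_den.[s] != 0 & (wronskian tausq_num tausq_den).[s] != 0].
Proof.
move=> /excludedP[[hA hB hF hQ] [hC hN hU hV] [hW hE hX]].
rewrite tausq_wronskian; split_factors.
by split; rewrite !mulf_neq0 ?expf_neq0 ?oppr_eq0 ?pnatr_eq0.
Qed.

Lemma tausq_neq0 s : excluded.[s] != 0 -> tausq s != 0.
Proof.
move=> sg; have [h _ _ _] := den_neq0 sg.
move: sg => /excludedP[[hA hB hF hQ] [hC hN hU hV] [hW hE hX]].
rewrite /tausq mulf_neq0 ?invr_eq0//; split_factors.
by rewrite !mulf_neq0 ?expf_neq0 ?oppr_eq0 ?pnatr_eq0.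
Qed.

(** dy/dT along y = 1/2 + tau k(s): d(tau)/dT = 1 and ds/dT = 2 tau / (tau^2)'. *)
Lemma ratio_slope s : excluded.[s] != 0 ->
  ratio s + 2 * tausq s * ((wronskian ratio_num ratio_den).[s] / ratio_den.[s] ^+ 2) / tausq' s = slope s.
Proof.
move=> /excludedP[[hA hB hF hQ] [hC hN hU hV] [hW hE hX]].
rewrite /ratio /tausq /tausq' /slope tausq_wronskian; split_factors.
move: hA hB hF hQ hC hN hU hV hW hE hX; rewrite !factorE ?deriv_factorE => hA hB hF hQ hC hN hU hV hW hE hX.
field.
by rewrite !(hA, hB, hF, hQ, hC, hN, hU, hV, hW).
Qed.

Lemma tausq_subE s : excluded.[s] != 0 -> tausq s - 1 / 4 =
  pU.[s] ^+ 2 * pV.[s] ^+ 3 * pW.[s] ^+ 5 / (pA.[s] ^+ 5 * pF.[s] ^+ 4 * pQ.[s] ^+ 3).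
Proof.
move=> /excludedP[[hA hB hF hQ] [hC hN hU hV] [hW hE hX]].
rewrite /tausq; split_factors.
move: hA hB hF hQ; rewrite !factorE => hA hB hF hQ.
field; by rewrite hA hF hQ.
Qed.

Lemma ratio_sub1E s : excluded.[s] != 0 -> ratio s - 1 =
  - 2 * (pU.[s] * pV.[s] ^+ 2 * pW.[s] ^+ 2 * pE.[s]) / (3 * pC.[s] * pN.[s]).
Proof.
move=> /excludedP[[hA hB hF hQ] [hC hN hU hV] [hW hE hX]].
rewrite /ratio; split_factors.
move: hC hN; rewrite !factorE => hC hN.
field; by rewrite hC hN.
Qed.

Lemma xsq_subE s : excluded.[s] != 0 -> tausq s * ratio s ^+ 2 - 1 / 4 =
  5 * pX.[s] * pU.[s] * pV.[s] ^+ 2 * pW.[s] ^+ 2 /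
  (pA.[s] ^+ 3 * pF.[s] ^+ 2 * pC.[s] ^+ 2 * pQ.[s]).
Proof.
move=> /excludedP[[hA hB hF hQ] [hC hN hU hV] [hW hE hX]].
rewrite /tausq /ratio; split_factors.
move: hA hF hQ hC hN; rewrite !factorE => hA hF hQ hC hN.
field; by rewrite hA hF hQ hC hN.
Qed.

(** The right-hand side of P_VI(1/3, 1/3, 1/3, 3/5) divided by tau, for G = tau^2,
    k = x / tau and g = dy/dT.  The variable X stands for
    x^2 - 1/4 = y (y - 1), and G - 1/4 is T (T - 1). *)
Definition reduced_rhs (G k g : C) : C :=
  let X := G * k ^+ 2 - 1 / 4 in
  1 / 2 * (2 * k / X + 1 / (G * (k - 1))) * g ^+ 2
  - (2 / (G - 1 / 4) + 1 / (G * (k - 1))) * g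
  + X * (k - 1) / (G - 1 / 4) ^+ 2
    * (2 / 25 - 1 / 18 * (1 / 2 + X - 2 * G * k) / X ^+ 2
       + 4 / 9 * (G - 1 / 4) / (G * (k - 1) ^+ 2)).

(** With theta_0 = theta_1 the terms at 0 and at 1 combine:
    1/y + 1/(y - 1) = 2 x / (x^2 - 1/4), and
    T/y^2 - (T - 1)/(y - 1)^2 = (1/4 + x^2 - 2 tau x) / (x^2 - 1/4)^2. *)
Lemma PVI_rhs_centred (tau k g : C) : tau != 0 -> k - 1 != 0 ->
  tau ^+ 2 - 1 / 4 != 0 -> tau ^+ 2 * k ^+ 2 - 1 / 4 != 0 ->
  PVI_rhs (1 / 3) (1 / 3) (1 / 3) (3 / 5) (1 / 2 + tau) (1 / 2 + tau * k) g =
  tau * reduced_rhs (tau ^+ 2) k g.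
Proof.
move=> t0 k1.
have -> : tau ^+ 2 * k ^+ 2 - 1 / 4 = (1 / 2 + tau * k) * (1 / 2 + tau * k - 1) by field.
have -> : tau ^+ 2 - 1 / 4 = (1 / 2 + tau) * (1 / 2 + tau - 1) by field.
rewrite !mulf_eq0 !negb_or => /andP[ta tb] /andP[xa xb].
rewrite /PVI_rhs /reduced_rhs /=.
have -> : 1 / 2 + tau * k - (1 / 2 + tau) = tau * (k - 1) by ring.
have -> : tau ^+ 2 * k ^+ 2 - 1 / 4 = (1 / 2 + tau * k) * (1 / 2 + tau * k - 1) by field.
have -> : tau ^+ 2 - 1 / 4 = (1 / 2 + tau) * (1 / 2 + tau - 1) by field.
have n2 : (2 : C) != 0 by rewrite pnatr_eq0.
field; rewrite k1 t0.
have -> : 1 + tau * k * 2 - 2 = 2 * (1 / 2 + tau * k - 1) by field.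
have -> : 1 + tau * k * 2 = 2 * (1 / 2 + tau * k) by field.
have -> : 1 + tau * 2 - 2 = 2 * (1 / 2 + tau - 1) by field.
have -> : 1 + tau * 2 = 2 * (1 / 2 + tau) by field.
by rewrite !mulf_neq0.
Qed.

(** The Painleve equation divided by tau.  The factorizations of T (T - 1),
    y (y - 1) and y - T keep the denominators products of known factors. *)
Lemma slope_equation s : excluded.[s] != 0 ->
  2 * slope' s / tausq' s = reduced_rhs (tausq s) (ratio s) (slope s).
Proof.
move=> sg; rewrite /reduced_rhs /= xsq_subE// tausq_subE// ratio_sub1E//.
move: sg => /excludedP[[hA hB hF hQ] [hC hN hU hV] [hW hE hX]].
rewrite /ratio /tausq /tausq' /slope /slope' tausq_wronskian; split_factors.
move: hA hB hF hQ hC hN hU hV hW hE hX; rewrite !factorE !deriv_factorE => hA hB hF hQ hC hN hU hV hW hE hX.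
field.
by rewrite !(hA, hB, hF, hQ, hC, hN, hU, hV, hW, hE, hX).
Qed.

(** * The solution near a point of the curve *)

(** y as a function of T, given s = S T. *)
Definition local_solution (S : C -> C) t := 1 / 2 + (t - 1 / 2) * ratio (S t).

Definition inverts_tausq (S : C -> C) t := [/\ excluded.[S t] != 0, tausq (S t) = (t - 1 / 2) ^+ 2
  & is_derive t (1 : C) S (2 * (t - 1 / 2) / tausq' (S t))].

Lemma tausq'_neq0 s : excluded.[s] != 0 -> tausq' s != 0.
Proof.
by move=> /den_neq0[d0 _ _ W0]; rewrite /tausq' mulf_neq0// invr_eq0 expf_neq0.
Qed.

Lemma derive_local_solution S t : inverts_tausq S t -> is_derive t (1 : C) (local_solution S) (slope (S t)).
Proof.
move=> [St0 Gt dS].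
have [_ r0 _ _] := den_neq0 St0.
have dr := is_derive_frac_comp ratio_num r0 dS.
have dt : is_derive t (1 : C) (fun u => u - 1 / 2) 1.
  exact: is_derive_shift t 1 (- (1 / 2)).
have dY := is_deriveD (is_derive_cst (1 / 2 : C) t 1) (is_deriveM dt dr).
apply: is_derive_eq dY _.
rewrite -ratio_slope// Gt /GRing.scale /= -/(ratio (S t)).
field; by rewrite tausq'_neq0.
Qed.

Lemma local_solution_PVI S t0 : (\forall t \near t0, inverts_tausq S t) ->
  \forall t \near t0, PVI_at (1 / 3) (1 / 3) (1 / 3) (3 / 5) (local_solution S) t.
Proof.
move=> invS; near=> t.
have near_inv : \forall u \near t, inverts_tausq S u by near: t; exact: (near_join invS).
have invt := nbhs_singleton near_inv; have [St0 Gt dS] := invt.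
have dY := derive_local_solution invt.
have [_ _ sl0 _] := den_neq0 St0.
have d2Y : is_derive t (1 : C) (local_solution S)^`()%classic (slope' (S t) * (2 * (t - 1 / 2) / tausq' (S t))).
  apply: near_eq_is_derive (is_derive_frac_comp slope_num sl0 dS).
  by apply: filterS near_inv => u /derive_local_solution[_ dE]; rewrite derive1E dE.
have dYE : (local_solution S)^`()%classic t = slope (S t) by rewrite derive1E; case: dY.
have tau0 : t - 1 / 2 != 0.
  by have := tausq_neq0 St0; rewrite Gt expf_eq0.
have tau1 : (t - 1 / 2) ^+ 2 - 1 / 4 != 0.
  rewrite -Gt tausq_subE//; move: St0 => /excludedP[[hA hB hF hQ] [hC hN hU hV] [hW hE hX]].
  by rewrite !mulf_neq0 ?invr_eq0 ?mulf_neq0 ?expf_neq0.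
have k1 : ratio (S t) - 1 != 0.
  rewrite ratio_sub1E//; move: St0 => /excludedP[[hA hB hF hQ] [hC hN hU hV] [hW hE hX]].
  by rewrite !mulf_neq0 ?invr_eq0 ?mulf_neq0 ?expf_neq0 ?oppr_eq0 ?pnatr_eq0.
have x1 : (t - 1 / 2) ^+ 2 * ratio (S t) ^+ 2 - 1 / 4 != 0.
  rewrite -Gt xsq_subE//; move: St0 => /excludedP[[hA hB hF hQ] [hC hN hU hV] [hW hE hX]].
  by rewrite !mulf_neq0 ?invr_eq0 ?mulf_neq0 ?expf_neq0 ?pnatr_eq0.
have tE : t = 1 / 2 + (t - 1 / 2) by rewrite addrC subrK.
split.
- move: tau1 x1; rewrite (_ : _ - 1 / 4 = t * (t - 1)); last by field.
  rewrite mulf_eq0 negb_or subr_eq0 => /andP[-> ->].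
  rewrite (_ : _ - 1 / 4 = local_solution S t * (local_solution S t - 1)); last by rewrite /local_solution; field.
  rewrite mulf_eq0 negb_or subr_eq0 => /andP[-> ->].
  split=> //; rewrite -subr_eq0 (_ : _ - t = (t - 1 / 2) * (ratio (S t) - 1)); last by rewrite /local_solution; field.
  exact: mulf_neq0.
- by case: dY.
- by case: d2Y.
rewrite derive1E dYE (_ : 'D_1 _ t = slope' (S t) * (2 * (t - 1 / 2) / tausq' (S t))); last by case: d2Y.
rewrite [X in PVI_rhs _ _ _ _ X]tE /local_solution PVI_rhs_centred// -Gt -slope_equation//.
field. exact: tausq'_neq0.
Unshelve. all: by end_near. Qed.

Lemma curve38_data s w : curve38 (s, w) -> excluded.[s] != 0 ->
  [/\ w != 0, (T38 s w - 1 / 2) ^+ 2 = tausq s & y38 s w = 1 / 2 + (T38 s w - 1 / 2) * ratio s].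
Proof.
rewrite /curve38 /= => sw /excludedP[[hA hB hF hQ] [hC hN hU hV] [hW hE hX]].
have w2 : w ^+ 2 = pA.[s] * pB.[s] * pQ.[s] by rewrite sw !factorE.
have w0 : w != 0.
  by rewrite -sqrf_eq0 w2 !mulf_neq0.
rewrite /T38 /y38 /ratio /tausq; split_factors.
split=> //.
  rewrite addrAC subrr add0r -!factorE expr_div_n [(_ * w) ^+ 2]exprMn w2; field.
  by rewrite hA hB hF hQ.
move: hA hB hF hQ hC hN; rewrite !factorE => hA hB hF hQ hC hN.
field. by rewrite w0 hA hF hQ hC hN.
Qed.

(** s is recovered from T by inverting s |-> tau^2 near s0, at the value
    (T - 1/2)^2. *)
Lemma curve38_local_solution s0 w0 : curve38 (s0, w0) -> excluded.[s0] != 0 ->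
  local_PVI_solution (1 / 3) (1 / 3) (1 / 3) (3 / 5) curve38 T38 y38 s0 w0.
Proof.
move=> sw0 s00.
have [d0 _ _ W0] := den_neq0 s00.
have [S [S_left S_right]] := frac_local_inverse d0 W0.
rewrite -/(tausq s0) in S_right.
have [_ T0 _] := curve38_data sw0 s00.
have S0 : S (tausq s0) = s0 by exact: (nbhs_singleton S_left).
have excluded_near s : excluded.[s] != 0 -> \forall u \near s, excluded.[u] != 0.
  by move=> b0; exact: cvgr_neq0 (@horner_continuous _ excluded s) b0.
pose R t := S ((t - 1 / 2) ^+ 2).
exists (local_solution R); split.
  have P1 : \forall s \near s0, excluded.[s] != 0 /\ S (tausq s) = s.
    by near=> s; split; near: s => //; exact: excluded_near.
  have : \forall p \near (s0, w0), excluded.[p.1] != 0 /\ S (tausq p.1) = p.1.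
    exact: (@cvg_fst _ _ (nbhs s0) (nbhs w0) _ _ P1).
  apply: filterS => -[s w] /= [bs SE] sw.
  have [_ Tw ->] := curve38_data sw bs.
  by rewrite /local_solution /R Tw SE.
apply: local_solution_PVI.
have S_good : \forall v \near tausq s0, [/\ excluded.[S v] != 0, tausq (S v) = v
    & is_derive v (1 : C) S (tausq_den.[S v] ^+ 2 / (wronskian tausq_num tausq_den).[S v])].
  near=> v.
  have [dv Gv dSv] : [/\ tausq_den.[S v] != 0, tausq_num.[S v] / tausq_den.[S v] = v &
      is_derive v (1 : C) S (tausq_den.[S v] ^+ 2 / (wronskian tausq_num tausq_den).[S v])] by near: v.
  split=> //; near: v.
  have Sc : S @ tausq s0 --> S (tausq s0).
    have [_ _ [dS _]] := nbhs_singleton S_right.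
    by apply/differentiable_continuous/derivable1_diffP.
  by apply: (Sc [set u | excluded.[u] != 0]); rewrite S0; exact: excluded_near.
have centred_sq_cvg : (fun t : C => (t - 1 / 2) ^+ 2) @ T38 s0 w0 --> tausq s0.
  rewrite -T0.
  have -> : (fun t : C => (t - 1 / 2) ^+ 2) = horner (('X - (1 / 2)%:P) ^+ 2).
    by apply/funext => t; rewrite horner_exp hornerXsubC.
  rewrite -[X in _ --> X](_ : (('X - (1 / 2)%:P) ^+ 2).[T38 s0 w0] = _).
    exact: horner_continuous.
  by rewrite horner_exp hornerXsubC.
near=> t.
have [bt Gt dS] : [/\ excluded.[R t] != 0, tausq (R t) = (t - 1 / 2) ^+ 2
    & is_derive ((t - 1 / 2) ^+ 2) (1 : C) S (tausq_den.[R t] ^+ 2 / (wronskian tausq_num tausq_den).[R t])].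
  by near: t; exact: (centred_sq_cvg _ S_good).
split=> //.
have dt : is_derive t (1 : C) (fun u => u - 1 / 2) 1.
  exact: is_derive_shift t 1 (- (1 / 2)).
have dsq : is_derive t (1 : C) (fun u => (u - 1 / 2) ^+ 2) (2 * (t - 1 / 2)).
  by apply: is_derive_eq (is_deriveX 2 dt) _; rewrite /GRing.scale /= mulr1.
apply: is_derive_eq (is_derive_comp dsq dS) _.
by rewrite /tausq' invf_div [RHS]mulrC.
Unshelve. all: by end_near. Qed.

Lemma curve38_solution : parametrizes_algebraic_PVI_solution
    (1 / 3) (1 / 3) (1 / 3) (3 / 5) (@curve38 C) T38 y38.
Proof.
split.
- apply: (nonconstant_curve38 excluded_neq0) => s w sw bs.
  have [w0 Tsq _] := curve38_data sw bs.
  have TN : T38 s (- w) - 1 / 2 = - (T38 s w - 1 / 2).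
    by rewrite /T38 mulrN invrN mulrN; ring.
  have T0 : T38 s w - 1 / 2 != 0.
    by have := tausq_neq0 bs; rewrite -Tsq expf_eq0.
  apply: contra_neq T0 => TE; move: TN; rewrite -TE => /eqP.
  by rewrite -addr_eq0 -mulr2n mulrn_eq0 /= => /eqP.
- have [Phi Phi0 PhiE] := fractions_dependent tausq_num tausq_den xsq_num xsq_den.
  have [Psi Psi0 PsiE] := dependence_of_centred_squares (1 / 2) Phi0.
  exists Psi => //; apply: (for_almost_all_curve38 excluded_neq0) => s w sw bs.
  have [w0 Tsq yE] := curve38_data sw bs.
  have [d0 r0 _ _] := den_neq0 bs.
  have yd0 : xsq_den.[s] != 0.
    move: bs => /excludedP[[hA hB hF hQ] [hC hN hU hV] [hW hE hX]].
    by rewrite /xsq_den hornerZ !hornerM !mulf_neq0 ?pnatr_eq0.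
  rewrite PsiE -[RHS](PhiE s d0 yd0) Tsq yE; congr (_.[_, _]).
  rewrite [_ - 1 / 2]addrAC subrr add0r exprMn Tsq.
  move: bs => /excludedP[[hA hB hF hQ] [hC hN hU hV] [hW hE hX]].
  rewrite /tausq /ratio /xsq_num /xsq_den; split_factors; field.
  by rewrite hA hF hQ hC hN.
apply: (for_almost_all_curve38 excluded_neq0); exact: curve38_local_solution.
Qed.

End Solution38.

Unset Implicit Arguments.
Set Strict Implicit.

Theorem mainTheorem4 (R : realType) :
  @parametrizes_algebraic_PVI_solution R[i]
    (1 / 3) (1 / 3) (1 / 3) (3 / 5) curve38 T38 y38.
Proof. exact: curve38_solution. Qed.
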